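(* Let $R=\{(0,2),(0,3),(2,0),(2,2),(2,3),(3,0),(3,2),(3,3)\}$. Then $(123,R)\sim_d(132,R)$.
   Context: $S_n$ denotes the set of permutations of $[n]=\{1,\dots,n\}$, written $\pi=\pi_1\cdots\pi_n$. A mesh pattern of length $k$ is a pair $(\tau,R)$ with $\tau\in S_k$ and $R\subseteq\{0,1,\dots,k\}^2$ (the shaded boxes; box $(a,b)$ is the unit square $[a,a+1]\times[b,b+1]$ in the diagram of $\tau$). An occurrence of $(\tau,R)$ in $\pi\in S_n$ is a choice of indices $i_1<\dots<i_k$ such that $\pi_{i_1}\cdots\pi_{i_k}$ is order-isomorphic to $\tau$ and, with $i_0=0$, $i_{k+1}=n+1$, $v_1<\dots<v_k$ the values $\pi_{i_1},\dots,\pi_{i_k}$ sorted increasingly, $v_0=0$, $v_{k+1}=n+1$, for every $(a,b)\in R$ there is no index $m$ with $i_a<m<i_{a+1}$ and $v_b<\pi_m<v_{b+1}$. Mesh patterns $p,q$ are equidistributed, $p\sim_d q$, if for all $n,\ell\ge0$ the number of $\pi\in S_n$ with exactly $\ell$ occurrences of $p$ equals the number with exactly $\ell$ occurrences of $q$. *)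

(* Defs.v *)
From mathcomp Require Import all_boot all_fingroup.

Set Implicit Arguments.
Unset Strict Implicit.
Unset Printing Implicit Defensive.

(* 'S_n acts on {0, ..., n-1}: the ordinal i stands for the index or value i + 1
   of [n]. Boxes (a, b) range over {0, ..., k}^2 with no shift. *)
Record mesh_pattern (k : nat) := MeshPattern {
  mesh_perm : 'S_k;
  mesh_shaded : {set 'I_k.+1 * 'I_k.+1}
}.

Section Occurrences.
Variables (k n : nat) (p : mesh_pattern k) (pi : 'S_n).
Implicit Type f : {ffun 'I_k -> 'I_n}.

Definition increasing_choice f : bool :=
  [forall a : 'I_k, forall b : 'I_k, (a < b) ==> (f a < f b)].

Definition order_isomorphic f : bool :=
  [forall a : 'I_k, forall b : 'I_k, (pi (f a) < pi (f b)) == (mesh_perm p a < mesh_perm p b)].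

(* i_0 = 0, i_1, ..., i_k, i_(k+1) = n+1, in 1-based numbering *)
Definition index_bounds f : seq nat :=
  0 :: rcons [seq (f j).+1 | j <- enum 'I_k] n.+1.

(* v_0 = 0, v_1 < ... < v_k, v_(k+1) = n+1, in 1-based numbering *)
Definition value_bounds f : seq nat :=
  0 :: rcons (sort leq [seq (pi (f j)).+1 | j <- enum 'I_k]) n.+1.

Definition point_in_box f (a b : nat) (m : 'I_n) : bool :=
  (nth 0 (index_bounds f) a < m.+1 < nth 0 (index_bounds f) a.+1) &&
  (nth 0 (value_bounds f) b < (pi m).+1 < nth 0 (value_bounds f) b.+1).

Definition mesh_occurrence f : bool :=
  [&& increasing_choice f, order_isomorphic f &
      [forall r in mesh_shaded p, ~~ [exists m : 'I_n, point_in_box f r.1 r.2 m]]].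

Definition mesh_occurrences : nat :=
  #|[set f : {ffun 'I_k -> 'I_n} | mesh_occurrence f]|.

End Occurrences.

Definition equidistributed (k k' : nat)
    (p : mesh_pattern k) (q : mesh_pattern k') : Prop :=
  forall n l : nat,
    #|[set pi : 'S_n | mesh_occurrences p pi == l]| =
    #|[set pi : 'S_n | mesh_occurrences q pi == l]|.

Definition boxes (k : nat) (s : seq (nat * nat)) : {set 'I_k.+1 * 'I_k.+1} :=
  [set r | (val r.1, val r.2) \in s].

Definition one_line (n : nat) (pi : 'S_n) : seq nat :=
  [seq (pi i).+1 | i <- enum 'I_n].

Definition perm123 : 'S_3 := 1%g.
Definition perm132 : 'S_3 := tperm (inord 1) (inord 2).

Lemma one_line_perm123 : one_line perm123 = [:: 1; 2; 3].
Proof. by rewrite /one_line !enum_ordSl enum_ord0 /= !perm1. Qed.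

Lemma one_line_perm132 : one_line perm132 = [:: 1; 3; 2].
Proof.
by rewrite /one_line !enum_ordSl enum_ord0 /= /perm132 !permE /=
           -!val_eqE /= !inordK.
Qed.

(* Main.v *)
Require Import Defs.
From mathcomp Require Import all_boot all_fingroup.
From mathcomp Require Import zify.

Set Implicit Arguments.
Unset Strict Implicit.
Unset Printing Implicit Defensive.

(** Let [j] be the position of the middle letter of an occurrence. For both
    patterns the shading says that the second and third letters are the two
    largest values at positions [>= j], that the first letter, at position
    [i < j], is below every value at positions [>= j], and that every value at
    positions [<= i] is below both of those largest values. These conditions do
    not depend on which of the two largest values comes first, which is all that
    separates 123 from 132. Exchanging these two values, when one of them is at
    position [j], is an involution that reverses their order for the middle
    position [j] and preserves everything for the other middle positions, so the
    patterns can be exchanged one middle position at a time. *)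

(** * Conditions on the two largest values from a position on *)

Section TopTwo.
Variable n : nat.
Implicit Types (pi : 'S_n) (i j m x y z : 'I_n).

Definition top_two pi j m : bool :=
  (j < m) && [forall x : 'I_n, [&& j <= x, x != j & x != m] ==>
                (pi x < pi j) && (pi x < pi m)].

(** The witnesses stand for the two largest values at positions [>= j]: if any two values there
    exceed all those up to [i], the two largest do. No third letter is named, so the condition can
    be compared before and after an exchange. *)
Definition dominated pi i j : bool :=
  [&& i < j, [forall x : 'I_n, (j <= x) ==> (pi i < pi x)] &
    [exists y : 'I_n, exists z : 'I_n, [&& y != z, j <= y, j <= z &
      [forall x : 'I_n, (x <= i) ==> (pi x < pi y) && (pi x < pi z)]]]].

Lemma top_twoP pi j m :
  reflect (j < m /\ forall x, j <= x -> x != j -> x != m -> pi x < pi j /\ pi x < pi m)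
          (top_two pi j m).
Proof.
apply: (iffP andP) => -[jm H]; split=> //.
  by move=> x h1 h2 h3; move/forallP/(_ x): H; rewrite h1 h2 h3 => /andP.
by apply/forallP=> x; apply/implyP=> /and3P[h1 h2 h3]; apply/andP/H.
Qed.

Lemma dominatedP pi i j :
  reflect [/\ i < j, forall x, j <= x -> pi i < pi x &
             exists y z, [/\ y != z, j <= y, j <= z &
               forall x, x <= i -> pi x < pi y /\ pi x < pi z]]
          (dominated pi i j).
Proof.
apply: (iffP and3P) => -[ij H1 H2]; split=> //.
- by move=> x jx; move/forallP/(_ x): H1; rewrite jx.
- case/existsP: H2 => y /existsP[z /and4P[yz jy jz /forallP H]].
  by exists y, z; split=> // x xi; move: (H x); rewrite xi => /andP.
- by apply/forallP=> x; apply/implyP=> /H1.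
- case: H2 => y [z [yz jy jz H]].
  apply/existsP; exists y; apply/existsP; exists z; rewrite yz jy jz /=.
  by apply/forallP=> x; apply/implyP=> /H /andP.
Qed.

(** Two distinct candidates would each have a value below the other's. *)
Lemma top_two_uniq pi j m m' : top_two pi j m -> top_two pi j m' -> m = m'.
Proof.
move=> /top_twoP[jm H] /top_twoP[jm' H']; apply/eqP/negPn/negP=> ne.
have [||| _ h] := H m'; rewrite ?(eq_sym m') // -?val_eqE /=; try lia.
have [||| _ h'] := H' m; rewrite // -?val_eqE /=; lia.
Qed.

Lemma tperm_geq j m x j' : j' <= j -> j' <= m -> (j' <= tperm j m x) = (j' <= x).
Proof. by move=> h1 h2; case: tpermP => [->|->|] //; rewrite h1 h2. Qed.

Lemma tperm_low j m x : j < m -> x < j -> tperm j m x = x.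
Proof. by move=> h1 h2; rewrite tpermD // -val_eqE /=; lia. Qed.

(** * The exchange at a fixed middle position *)

Section Swap.
Variables (pi : 'S_n) (j m : 'I_n).
Hypothesis jm_top : top_two pi j m.
Let pi' := (tperm j m * pi)%g.

Let lt_jm : j < m. Proof. by case/top_twoP: jm_top. Qed.

Lemma swap_top_two : top_two pi' j m.
Proof.
have [_ H] := top_twoP _ _ _ jm_top; apply/top_twoP; split=> // x h1 h2 h3.
rewrite /pi' !permM tpermL tpermR tpermD 1?eq_sym //.
by have [] := H x h1 h2 h3.
Qed.

(** After [j] only the value at [m] changes, from [pi m] to [pi j], and both exceed every other
    value there. *)
Lemma swap_ltn_after x y : j < x -> j < y -> (pi' x < pi' y) = (pi x < pi y).
Proof.
have [_ H] := top_twoP _ _ _ jm_top => jx jy.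
have nj z : j < z -> z != j by move=> jz; rewrite -val_eqE /=; lia.
have P' z : j < z -> z != m -> pi' z = pi z.
  by move=> jz zm; rewrite /pi' permM tpermD 1?eq_sym ?nj.
have Pm : pi' m = pi j by rewrite /pi' permM tpermR.
have [->|xm] := eqVneq x m; have [->|ym] := eqVneq y m; rewrite ?ltnn //.
- by rewrite Pm P' //; have [] := H y (ltnW jy) (nj _ jy) ym; lia.
- by rewrite Pm P' //; have [] := H x (ltnW jx) (nj _ jx) xm; lia.
by rewrite !P'.
Qed.

Lemma swap_top_two_after j' m' : j < j' -> top_two pi' j' m' = top_two pi j' m'.
Proof.
move=> jj'; apply/top_twoP/top_twoP => -[h H]; split=> // x h1 h2 h3.
  by have := H x h1 h2 h3; rewrite !swap_ltn_after //; lia.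
by rewrite !swap_ltn_after //; [exact: H | lia..].
Qed.

(** The exchange fixes [j'] and permutes the later positions, so the third letter keeps its value
    and moves with the transposition. *)
Lemma swap_top_two_before j' m' :
  j' < j -> top_two pi j' m' -> top_two pi' j' (tperm j m m').
Proof.
move=> j'j /top_twoP[h H].
have j'm : j' < m by exact: ltn_trans lt_jm.
have E := tperm_low lt_jm j'j.
apply/top_twoP; split.
  by case: tpermP => [_|_|].
move=> x h1 h2 h3; rewrite /pi' !permM tpermK E.
apply: H; first by rewrite tperm_geq // ltnW.
  by rewrite -[X in _ != X]E (inj_eq perm_inj).
by rewrite -[X in _ != X](tpermK j m) (inj_eq perm_inj).
Qed.

Lemma swap_dominated i j' : dominated pi i j' -> dominated pi' i j'.
Proof.
have [_ T] := top_twoP _ _ _ jm_top.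
move=> /dominatedP[ij' H1 [y [z [yz jy jz H2]]]].
have low x : x < j -> pi' x = pi x by move=> h; rewrite /pi' permM tperm_low.
(* For [j' <= j] the positions from [j'] on are permuted and those up to [i] are fixed, so the
   witnesses move with the transposition. *)
have [jj'|j'j] := ltnP j j'; last first.
  have h1 := leq_trans j'j (ltnW lt_jm).
  apply/dominatedP; split=> //.
    move=> x j'x; rewrite low; last by lia.
    by rewrite /pi' permM; apply: H1; rewrite tperm_geq.
  exists (tperm j m y), (tperm j m z).
  rewrite (inj_eq perm_inj) !tperm_geq //; split=> // x xi.
  by rewrite low ?/pi' ?permM ?tpermK; [exact: H2|lia].
(* One of y, z lies after j and is not m, so its value is below pi j. *)
have [t [j't tm Ht]] : exists t : 'I_n, [/\ j' <= t, t != m & forall x, x <= i -> pi x < pi t].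
  have [ym|ym] := eqVneq y m.
    by exists z; rewrite -ym eq_sym; split=> // x /H2[].
  by exists y; split=> // x /H2[].
have [tj1 _] : pi t < pi j /\ pi t < pi m.
  by apply: T; rewrite // -?val_eqE /=; lia.
(* Otherwise [Ht] at [j] gives [pi j < pi t], against [tj1]. Hence the positions up to [i] keep
   their values. *)
have ilj : i < j.
  by rewrite ltnNge; apply/negP=> /Ht; lia.
(* Only the value at [m] can drop, and it becomes [pi j], still above [pi t]. *)
have up x : j' <= x -> pi x <= pi' x \/ pi t < pi' x.
  move=> j'x; have [->|xm] := eqVneq x m; first by rewrite /pi' permM tpermR; right.
  by left; rewrite /pi' permM tpermD // eq_sym // -val_eqE /=; lia.
apply/dominatedP; split=> //.
  move=> x j'x; rewrite low //.
  case: (up x j'x); [exact: leq_trans (H1 x j'x) | exact: ltn_trans (H1 t j't)].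
exists y, z; split=> // x xi; rewrite low; last by lia.
have [xy xz] := H2 x xi; have xt := Ht x xi.
have lift (w : 'I_n) : j' <= w -> pi x < pi w -> pi x < pi' w.
  by move=> /up[h xw|h _]; [exact: leq_trans h | exact: ltn_trans h].
by split; apply: lift.
Qed.

End Swap.

(** * The exchange as an involution, and counts between the two patterns *)

Definition swap_top j pi : 'S_n :=
  if [pick m | top_two pi j m] is Some m then (tperm j m * pi)%g else pi.

Variant swap_top_spec j pi : 'S_n -> Prop :=
| SwapTop m of top_two pi j m : swap_top_spec j pi (tperm j m * pi)%g
| SwapId of (forall m, ~~ top_two pi j m) : swap_top_spec j pi pi.

Lemma swap_topP j pi : swap_top_spec j pi (swap_top j pi).
Proof.
rewrite /swap_top; case: pickP => [m|H]; first exact: SwapTop.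
by apply: SwapId => m; rewrite H.
Qed.

Lemma swap_topE j m pi : top_two pi j m -> swap_top j pi = (tperm j m * pi)%g.
Proof.
move=> t; case: swap_topP => [m' t'|/(_ m)]; last by rewrite t.
by rewrite (top_two_uniq t t').
Qed.

Lemma swap_topK j : involutive (swap_top j).
Proof.
move=> pi; case: (swap_topP j pi) => [m t|H].
  by rewrite (swap_topE (swap_top_two t)) mulgA tperm2 mul1g.
by case: swap_topP => // m; rewrite (negPf (H m)).
Qed.

Lemma dominated_swap_top j pi i j' :
  dominated (swap_top j pi) i j' = dominated pi i j'.
Proof.
have D p : dominated p i j' -> dominated (swap_top j p) i j'.
  by case: swap_topP => // m t; apply: swap_dominated.
by apply/idP/idP => /D //; rewrite swap_topK.
Qed.

(** The value [true] of [b] belongs to 123, [false] to 132. *)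
Definition top_order b pi j : bool :=
  [exists m : 'I_n, top_two pi j m && ((pi j < pi m) == b)].

Lemma top_order_swap_top j pi b : top_order b (swap_top j pi) j = top_order (~~ b) pi j.
Proof.
have D p c : top_order c p j -> top_order (~~ c) (swap_top j p) j.
  case/existsP=> m /andP[t /eqP c_eq]; apply/existsP; exists m.
  rewrite (swap_topE t) swap_top_two //= !permM tpermL tpermR -c_eq.
  have /top_twoP[jm _] := t.
  have : p j != p m :> nat.
    by rewrite val_eqE (inj_eq perm_inj) -val_eqE /=; lia.
  lia.
by apply/idP/idP => /D; rewrite ?swap_topK ?negbK.
Qed.

Lemma top_order_swap_top_neq j j' pi b :
  j' != j -> top_order b (swap_top j pi) j' = top_order b pi j'.
Proof.
move=> ne.
have D p : top_order b p j' -> top_order b (swap_top j p) j'.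
  case/existsP=> m' /andP[t' c_eq]; case: swap_topP => [m t|_]; last first.
    by apply/existsP; exists m'; rewrite t'.
  have /top_twoP[jm _] := t; have /top_twoP[jm' _] := t'; apply/existsP.
  have [jj'|j'j|e] := ltngtP j j'; last by move: ne; rewrite (val_inj e) eqxx.
    by exists m'; rewrite swap_top_two_after // swap_ltn_after ?t' //; lia.
  exists (tperm j m m'); rewrite swap_top_two_before //.
  by rewrite !permM tpermK tperm_low.
by apply/idP/idP => /D //; rewrite swap_topK.
Qed.

(* Counts 123-occurrences with middle position below k and 132-occurrences with
   middle position at least k. *)
Definition hybrid k pi : nat :=
  #|[set ij | dominated pi ij.1 ij.2 && top_order (ij.2 < k) pi ij.2]|.

(** The thresholds [j] and [j.+1] disagree only at middle position [j], exactly where the exchange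
    reverses the order. *)
Lemma hybrid_swap_top j pi : hybrid j (swap_top j pi) = hybrid j.+1 pi.
Proof.
apply: eq_card => -[i j']; rewrite !inE /= dominated_swap_top.
have [->|ne] := eqVneq j' j; first by rewrite top_order_swap_top ltnn ltnSn.
by rewrite top_order_swap_top_neq // ltnS [in RHS]leq_eqVlt val_eqE (negPf ne).
Qed.

Lemma hybrid_equidistributed l k : k <= n ->
  #|[set pi | hybrid k pi == l]| = #|[set pi | hybrid 0 pi == l]|.
Proof.
elim: k => // k IH kn; rewrite -IH ?(ltnW kn) //.
rewrite -[RHS](card_preimset _ (inv_inj (@swap_topK (Ordinal kn)))).
by apply: eq_card => pi; rewrite !inE (hybrid_swap_top (Ordinal kn)).
Qed.

End TopTwo.

(** * Letters, boxes and sorted values for patterns of length three *)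

Definition o30 : 'I_3 := @Ordinal 3 0 isT.
Definition o31 : 'I_3 := @Ordinal 3 1 isT.
Definition o32 : 'I_3 := @Ordinal 3 2 isT.

Lemma enum_I3 : enum 'I_3 = [:: o30; o31; o32].
Proof. by apply: (inj_map val_inj); rewrite val_enum_ord. Qed.

Lemma forall_I3 (P : pred 'I_3) :
  [forall a, P a] = [&& P o30, P o31 & P o32].
Proof.
apply/forallP/and3P => [H|[h0 h1 h2] a]; first by split.
have : a \in enum 'I_3 by rewrite mem_enum.
by rewrite enum_I3 !inE => /or3P[] /eqP->.
Qed.

(** Lets one point be tested against all boxes at once. The bound on [s] ensures that [boxes] drops
    no pair. *)
Lemma forall_boxes_empty k n (s : seq (nat * nat)) (P : nat -> nat -> pred 'I_n) :
  all (fun r => (r.1 <= k) && (r.2 <= k)) s ->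
  [forall r in boxes k s, ~~ [exists m, P r.1 r.2 m]] =
  [forall m, all (fun r => ~~ P r.1 r.2 m) s].
Proof.
move=> /allP sk; apply/forallP/forallP => [H m|H [a b]].
  apply/allP => -[a b] ab; have /andP[/= ak bk] := sk _ ab.
  have := H (Ordinal (ak : a < k.+1), Ordinal (bk : b < k.+1)).
  by rewrite inE /= ab negb_exists => /forallP.
rewrite inE /=; apply/implyP => ab; rewrite negb_exists; apply/forallP => m.
by move/allP: (H m) => /(_ _ ab).
Qed.

Lemma sort3 (u v w : nat) : u < v -> u < w ->
  sort leq [:: u; v; w] = [:: u; minn v w; maxn v w].
Proof.
move=> uv uw.
have srt : sorted leq [:: u; minn v w; maxn v w] by rewrite /=; lia.
rewrite -(sorted_sort leq_trans srt); apply/(perm_sortP leq_total leq_trans anti_leq).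
rewrite perm_cons /minn /maxn; case: ltnP => // _.
by rewrite (perm_catC [:: v] [:: w]).
Qed.

Definition shading := [:: (0, 2); (0, 3); (2, 0); (2, 2);
                          (2, 3); (3, 0); (3, 2); (3, 3)].

(** * Occurrences of both patterns, treated uniformly through [b] *)

Section Occurrence.
Variables (n : nat) (tau : 'S_3) (b : bool).
Hypotheses (tau01 : tau o30 < tau o31) (tau02 : tau o30 < tau o32).
Hypothesis tau12 : (tau o31 < tau o32) = b.
Implicit Types (pi : 'S_n) (f : {ffun 'I_3 -> 'I_n}).

Lemma mesh_occurrenceE pi f :
  mesh_occurrence (MeshPattern tau (boxes 3 shading)) pi f =
  [&& dominated pi (f o30) (f o31), top_two pi (f o31) (f o32) &
      (pi (f o31) < pi (f o32)) == b].
Proof.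
rewrite /mesh_occurrence (forall_boxes_empty (point_in_box pi f)) //.
set box := [forall m, _].
set p := f o30; set q := f o31; set r := f o32.
have injP (x y : 'I_n) : (pi x == pi y :> nat) = (x == y :> nat).
  by rewrite !val_eqE (inj_eq perm_inj).
have -> : increasing_choice f = (p < q) && (q < r).
  by rewrite /increasing_choice !forall_I3 /= -/p -/q -/r; lia.
have [pq|] /= := ltnP p q; last first.
  by move=> qp; apply/esym/negbTE/negP => /andP[/dominatedP[]]; rewrite ltnNge qp.
have [qr|] /= := ltnP q r; last first.
  by move=> rq; apply/esym/negbTE/negP => /and3P[_ /top_twoP[]]; rewrite ltnNge rq.
have -> : order_isomorphic (MeshPattern tau (boxes 3 shading)) pi f =
          [&& pi p < pi q, pi p < pi r & (pi q < pi r) == b].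
  rewrite /order_isomorphic !forall_I3 /= -/p -/q -/r -tau12.
  have := injP q r; have := injP p q; have := injP p r.
  have := tau01; have := tau02; have : tau o31 != tau o32 :> nat.
    by rewrite val_eqE (inj_eq perm_inj).
  lia.
have [upq|] /= := ltnP (pi p) (pi q); last first.
  move=> h; apply/esym/negbTE/negP => /andP[/dominatedP[_ /(_ q (leqnn q))]].
  by rewrite ltnNge h.
have [upr|] /= := ltnP (pi p) (pi r); last first.
  move=> h; apply/esym/negbTE/negP => /andP[/dominatedP[_ /(_ r (ltnW qr))]].
  by rewrite ltnNge h.
rewrite andbC andbA; congr (_ && _).
(* The clauses come from the boxes in row 0, from those in columns 2, 3 and rows 2, 3, and from
   those in column 0. Boxes are open; the boundary cases added by [<=] hold by [upq] and [upr]. *)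
have boxE m : all (fun s => ~~ point_in_box pi f s.1 s.2 m) shading =
  [&& (q <= m) ==> (pi p < pi m), 
      [&& q <= m, m != q & m != r] ==> (pi m < pi q) && (pi m < pi r) &
      (m <= p) ==> (pi m < pi q) && (pi m < pi r)].
  rewrite /point_in_box /index_bounds /value_bounds enum_I3 /= -/p -/q -/r sort3 //=.
  rewrite minnSS maxnSS !ltnS !ltn_ord !andbT -!val_eqE /=.
  have ne_qr : (pi q == pi r :> nat) = false by rewrite injP; lia.
  move: (injP m p) (injP m q) (injP m r) upq upr ne_qr.
  case: (ltngtP (pi q) (pi r)) => // vw mP mQ mR upq upr _;
    rewrite ?(minn_idPl (ltnW vw)) ?(minn_idPr (ltnW vw));
    rewrite ?(maxn_idPl (ltnW vw)) ?(maxn_idPr (ltnW vw)); move: mP mQ mR;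
    case: (ltngtP m p) => mp; case: (ltngtP m q) => mq; try (exfalso; lia);
    case: (ltngtP m r) => mr; try (exfalso; lia);
    case: (ltngtP (pi m) (pi p)) => // yu _; case: (ltngtP (pi m) (pi q)) => // yv _;
    case: (ltngtP (pi m) (pi r)) => //= yw _; lia.
apply/forallP/andP => [H|[/dominatedP[_ H1 [y [z [yz qy qz H2]]]] /top_twoP[_ H3]] m].
  have {}H (m : 'I_n) := etrans (esym (boxE m)) (H m).
  split.
    apply/dominatedP; split=> //.
      by move=> x qx; case/and3P: (H x); rewrite qx.
    exists q, r; rewrite leqnn (ltnW qr) -val_eqE /=; split=> //; first by lia.
    by move=> x xp; case/and3P: (H x) => _ _; rewrite xp => /andP.
  apply/top_twoP; split=> // x h1 h2 h3.
  by case/and3P: (H x) => _; rewrite h1 h2 h3 => /andP.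
rewrite boxE; apply/and3P; split; apply/implyP.
- exact: H1.
- by case/and3P=> h1 h2 h3; apply/andP/H3.
move=> /H2[my mz].
(* A witness other than [q] and [r] has a value below both of theirs, so it bounds [pi m] well
   enough; failing that, the distinct witnesses are [q] and [r] themselves. *)
have out (w : 'I_n) : q <= w -> w \notin [:: q; r] -> pi m < pi w ->
    (pi m < pi q) && (pi m < pi r).
  rewrite !inE => qw /norP[wq wr] mw; have [h1 h2] := H3 w qw wq wr.
  by rewrite (ltn_trans mw h1) (ltn_trans mw h2).
have [yqr|/out] := boolP (y \in [:: q; r]); last exact.
have [zqr|/out] := boolP (z \in [:: q; r]); last exact.
move: yqr zqr my mz yz; rewrite !inE.
by case/orP=> /eqP-> /orP[]/eqP->; rewrite ?eqxx // => -> ->.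
Qed.

(** Forgetting the third position is injective on occurrences, by [top_two_uniq]. *)
Lemma mesh_occurrencesE pi :
  mesh_occurrences (MeshPattern tau (boxes 3 shading)) pi =
  #|[set ij | dominated pi ij.1 ij.2 && top_order b pi ij.2]|.
Proof.
pose g f := (f o30, f o31).
rewrite /mesh_occurrences -(card_in_imset (f := g)).
  apply: eq_card => -[i j]; rewrite inE /=; apply/imsetP/andP.
    case=> f; rewrite inE mesh_occurrenceE => /and3P[d t o] [-> ->].
    by split=> //; apply/existsP; exists (f o32); rewrite t.
  case=> d /existsP[m tm].
  exists [ffun a : 'I_3 => nth i [:: i; j; m] a]; last by rewrite /g !ffunE.
  by rewrite inE mesh_occurrenceE !ffunE /= d tm.
move=> f f'; rewrite !inE !mesh_occurrenceE => /and3P[_ t _] /and3P[_ t' _] [e0 e1].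
have e2 : f o32 = f' o32 by apply: (top_two_uniq t); rewrite e1.
apply/ffunP=> a; have : a \in enum 'I_3 by rewrite mem_enum.
by rewrite enum_I3 !inE => /or3P[] /eqP->.
Qed.

End Occurrence.

Theorem theorem4p8 :
  let R := boxes 3 [:: (0, 2); (0, 3); (2, 0); (2, 2);
                       (2, 3); (3, 0); (3, 2); (3, 3)] in
  equidistributed (MeshPattern perm123 R) (MeshPattern perm132 R).
Proof.
move=> R n l.
(* All middle positions lie below [n] and none below 0, so these two thresholds give the pure
   counts. *)
have E123 (pi : 'S_n) : mesh_occurrences (MeshPattern perm123 R) pi = hybrid n pi.
  rewrite (@mesh_occurrencesE _ _ true) ?perm1 //.
  by apply: eq_card => -[i j]; rewrite !inE ltn_ord.
have o1 : inord 1 = o31 by apply: val_inj; rewrite /= inordK.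
have o2 : inord 2 = o32 by apply: val_inj; rewrite /= inordK.
have E132 (pi : 'S_n) : mesh_occurrences (MeshPattern perm132 R) pi = hybrid 0 pi.
  rewrite (@mesh_occurrencesE _ _ false) /perm132 ?o1 ?o2 ?tpermL ?tpermR ?tpermD //.
under eq_finset do rewrite E123.
under [in RHS]eq_finset do rewrite E132.
exact: hybrid_equidistributed.
Qed.
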